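(* Let $X$ be a metric space whose metric $d$ is proper and open, and let $r>0$. (a) If $C$ is an $r$-maximal subset of $X$, then $C$ is compact, and for every $x_1$ in the topological boundary of $C$ there is a point $x_2$ in the topological boundary of $C$ with $d(x_1,x_2)=r$. Furthermore, $C=\{x\in X: d_+(C,x)\le r\}$ and the interior of $C$ is $\{x\in X: d_+(C,x)<r\}$. If, in addition, the metric is connected, then $C$ is connected. (b) Assume in addition that the metric is connected and that $C$ is a compact $r$-bounded subset of $X$ with nonempty interior. If for every point $x$ of the topological boundary of $C$ there is a point $y\in C$ with $d(x,y)=r$, then $C$ is $r$-maximal.
   Context: Let $(X,d)$ be a metric space (nonempty). A subset of $X$ is $r$-bounded if its diameter is at most $r$; it is $r$-maximal if it is maximal (with respect to inclusion) among the $r$-bounded subsets of $X$. The metric $d$ is proper if for every $x\in X$ the map $y\mapsto d(x,y)$ from $X$ to $[0,\infty)$ is proper (equivalently, closed bounded subsets of $X$ are compact). It is open if for every $x\in X$ the map $y\mapsto d(x,y)$ from $X$ to $[0,\infty)$ is an open map. For a nonempty compact $C\subset X$ and $x\in X$, $d_+(C,x)=\max\{d(x,y):y\in C\}$. The metric $d$ is connected if for every nonempty compact $C\subset X$ and every $r>0$ the open set $\{x\in X:d_+(C,x)<r\}$ is connected and, when it is nonempty, its closure is $\{x\in X:d_+(C,x)\le r\}$. *)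

(* Defs.v *)
From HB Require Import structures.
From mathcomp Require Import all_boot all_order all_algebra.
From mathcomp Require Import all_classical all_reals all_analysis.

Set Implicit Arguments.
Unset Strict Implicit.
Unset Printing Implicit Defensive.

Import Order.TTheory GRing.Theory Num.Theory.
Import numFieldTopology.Exports numFieldNormedType.Exports.

Local Open Scope classical_set_scope.
Local Open Scope ring_scope.

Definition boundary (T : topologicalType) (A : set T) : set T :=
  closure A `\` interior A.

Section metric_notions.
Context {R : realType} {X : metricType R}.
Implicit Types (A B C : set X) (x y : X) (r : R).

(* [diam set0] is -oo, so the empty set is r-bounded for every r. *)
Definition diam A : \bar R :=
  ereal_sup [set (mdist x y)%:E | x in A & y in A].

Definition r_bounded r A : Prop := (diam A <= r%:E)%E.

Definition r_maximal r A : Prop :=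
  r_bounded r A /\ forall B, r_bounded r B -> A `<=` B -> B = A.

(* The codomain of y |-> d(x, y) is [0, +oo[, so properness only tests compact
   sets contained in it. *)
Definition proper_metric : Prop :=
  forall x (K : set R), K `<=` `[0, +oo[ -> compact K ->
    compact (mdist x @^-1` K).

(* Images are relatively open in [0, +oo[, not open in R: the image of a
   neighbourhood of x contains 0. *)
Definition open_metric : Prop :=
  forall x (U : set X), open U ->
    exists2 V : set R, open V & mdist x @` U = `[0, +oo[ `&` V.

(* The supremum is attained when C is nonempty and compact, see
   [dist_maxP]. *)
Definition dist_max C x : R := sup [set mdist x y | y in C].

Definition connected_metric : Prop :=
  forall C r, C !=set0 -> compact C -> 0 < r ->
    connected [set x | dist_max C x < r] /\
    ([set x | dist_max C x < r] !=set0 ->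
     closure [set x | dist_max C x < r] = [set x | dist_max C x <= r]).

Lemma continuous_mdist x : continuous (mdist x).
Proof.
move=> y; apply/cvgrPdist_lt => e e0; near=> z.
have yz : mdist y z < e.
  near: z; have := nbhsx_ballx y e e0; by rewrite ballEmdist.
rewrite (le_lt_trans _ yz)// ler_norml lerBlDl lerNl opprB lerBlDl.
by rewrite metric_triangle/= (metric_sym y z) metric_triangle.
Unshelve. all: by end_near. Qed.

Lemma dist_maxP C x : C !=set0 -> compact C ->
  exists y, [/\ C y, dist_max C x = mdist x y &
    forall z, C z -> mdist x z <= mdist x y].
Proof.
move=> C0 cC.
have [|c] := @compact_EVT_max X R (mdist x) C C0 cC.
  exact/continuous_subspaceT/continuous_mdist.
rewrite inE => Cc cmax; have cm z : C z -> mdist x z <= mdist x c.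
  by move=> Cz; apply: cmax; rewrite inE.
exists c; split=> //; apply/eqP; rewrite eq_le; apply/andP; split.
  by apply: ge_sup; [exists (mdist x c), c|move=> _ [z Cz <-]; exact: cm].
apply: ub_le_sup; last by exists c.
by exists (mdist x c) => _ [z Cz <-]; exact: cm.
Qed.

End metric_notions.

Arguments proper_metric {R} X.
Arguments open_metric {R} X.
Arguments connected_metric {R} X.

(* Main.v *)
Require Import Defs.
From mathcomp Require Import all_boot all_order all_algebra.
From mathcomp Require Import all_classical all_reals all_analysis.

(** Write d_+ for [dist_max C] and D for the set of x with d_+ x <= r.  Every
    r-bounded set containing C lies in D, and each single point of D can be
    added to an r-bounded C without breaking r-boundedness; hence an r-maximal C
    is D.  The closure of an r-bounded set is r-bounded, so a maximal one is
    closed, and compact because the metric is proper.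

    Openness of the metric enters through one fact: near any point y the
    distance to a fixed x takes values larger than d(x, y)
    ([open_metric_increase]).  So in an r-bounded set a point at distance r from
    some other point is never interior ([r_bounded_interior]).  This puts the
    interior of C inside the open set where d_+ < r, and for a maximal C the
    converse inclusion is clear from C = D.  A boundary point of a maximal C thus
    has d_+ = r; the point of C that realizes this maximum is itself not
    interior, by the same fact, and is the required partner.

    For the connectedness of a maximal C = D, the set D is the decreasing
    intersection of the connected sets where d_+ < s, for s > r.  A splitting of
    D into two closed pieces, separated by disjoint open sets U and V, would by
    compactness split one of these sets already
    ([connected_closed_sublevel]).

    For (b), the hypothesis on the boundary says that the connected set where
    d_+ < r avoids the boundary of C, so it is covered by the interior and the
    complement of C.  It contains the nonempty interior, hence lies in C
    ([dist_max_lt_sub_of_boundary]).  Taking closures gives that D is contained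
    in C, and D contains every r-bounded superset of C. *)

Import Order.TTheory GRing.Theory Num.Theory.
Import numFieldTopology.Exports numFieldNormedType.Exports.

Local Open Scope classical_set_scope.
Local Open Scope ring_scope.

(** * Separation and sublevel sets *)

Lemma closure_sub_closed (T : topologicalType) (A F : set T) :
  closed F -> A `<=` F -> closure A `<=` F.
Proof. by move=> clF /closure_subset; rewrite -(closure_id F).1. Qed.

Lemma closed_sublevel (R : realType) (T : topologicalType) (f : T -> R) a :
  continuous f -> closed [set x | f x <= a].
Proof.
move=> cf; apply: (@preimage_closed _ _ f [set y | y <= a]); last exact: closed_le.
by move=> x _; exact: cf.
Qed.

Lemma separated_subset_open (T : topologicalType) (U V A B : set T) :
  open U -> open V -> U `&` V = set0 -> A `<=` U -> B `<=` V ->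
  separated A B.
Proof.
have half (U' V' A' B' : set T) : open V' -> U' `&` V' = set0 ->
    A' `<=` U' -> B' `<=` V' -> closure A' `&` B' = set0.
  move=> oV UV AU BV; rewrite -subset0 => x [clAx /BV Vx].
  have [y [/AU Uy Vy]] := clAx V' (open_nbhs_nbhs (conj oV Vx)).
  by have : (U' `&` V') y by []; rewrite UV.
move=> oU oV UV AU BV; split; first exact: half UV AU BV.
by rewrite setIC; apply: half BV AU => //; rewrite setIC.
Qed.

(** The set where f <= a is the decreasing intersection of the connected sets
    where f < s.  If it split, normality would give disjoint open sets U and V
    around the two pieces; on the compact set where f <= b outside U and V the
    minimum of f exceeds a, and below this minimum everything lies in U or V,
    which contradicts connectedness there.  Passing to the limit in s, rather
    than taking the closure of the set where f < a, covers the case in which the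
    latter set is empty. *)
Lemma connected_closed_sublevel (R : realType) (T : topologicalType)
    (f : T -> R) (a b : R) :
  normal_space T -> continuous f -> a < b -> compact [set x | f x <= b] ->
  (forall s, a < s -> s <= b -> connected [set x | f x < s]) ->
  connected [set x | f x <= a].
Proof.
move=> nT cf ab cK conn; apply: contrapT.
move=> /connectedPn[E [E0 EU [sep1 sep2]]].
have clE c : closed (E c).
  have EA : E c `<=` [set x | f x <= a].
    by rewrite EU; case: c => x Ex; [right|left].
  move=> x clx.
  have := closure_sub_closed _ _ _ (closed_sublevel _ _ f a cf) EA x clx.
  rewrite EU; case: c clx {EA} => clx [] // Ex.
    by have : set0 x by rewrite -sep2.
  by have : set0 x by rewrite -sep1.
have E_disj : E false `&` E true = set0 by apply: separated_disjoint.
have [U [V [oU oV EUU EVV UV0]]] :=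
  (@normal_openP R T).1 nT _ _ (clE false) (clE true) E_disj.
(* The threshold s is the minimum of f on K, or b when K is empty. *)
have [s [a_s sb sUV]] : exists s,
    [/\ a < s, s <= b & [set x | f x < s] `<=` U `|` V].
  pose K := [set x | f x <= b] `\` (U `|` V).
  have cptK : compact K.
    apply: (subclosed_compact _ cK); last by move=> x [].
    apply: closedI; first exact: closed_sublevel.
    exact/open_closedC/openU.
  have [K0|] := pselect (K !=set0); last first.
    move=> nK; exists b; split=> // x /ltW fxb; apply: contrapT => nUV.
    by apply: nK; exists x.
  have [|m mK mmin] := @compact_EVT_min _ R f K K0 cptK.
    exact/continuous_subspaceT.
  have [fmb mUV] : K m by rewrite inE in mK.
  exists (f m); split=> //.
    rewrite ltNge; apply/negP => fma; apply: mUV.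
    have : [set x | f x <= a] m by [].
    by rewrite EU => -[/EUU|/EVV]; [left|right].
  move=> x /= fxm; apply: contrapT => nUV.
  have : K x by split=> //; exact: (le_trans (ltW fxm)).
  by move=> Kx; have := mmin x (mem_set Kx); rewrite leNgt fxm.
have sub x : E false x \/ E true x -> f x < s.
  move=> Ex; apply: le_lt_trans a_s.
  by have : [set x | f x <= a] x by rewrite EU.
have sepUV : separated U V by exact: separated_subset_open UV0 _ _.
have [y Ey] := E0 false; have [z Ez] := E0 true.
have [sU|sV] := connected_subset sepUV sUV (conn s a_s sb).
  have : (U `&` V) z by split; [apply: sU; apply: sub; right|exact: EVV].
  by rewrite UV0.
have : (U `&` V) y by split; [exact: EUU|apply: sV; apply: sub; left].
by rewrite UV0.
Qed.

(** * Bounded sets in proper and open metrics *)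

Section bounded_sets.
Context {R : realType} {X : metricType R}.
Implicit Types (A B C : set X) (x y : X) (r s : R).

Lemma r_boundedP r A :
  r_bounded r A <-> forall x y, A x -> A y -> mdist x y <= r.
Proof.
split=> [Ar x y Ax Ay|Ar].
  rewrite -lee_fin; apply: le_trans Ar; apply: ereal_sup_ubound.
  by exists x => //; exists y.
by apply: ge_ereal_sup => _ [x Ax [y Ay <-]]; rewrite lee_fin; exact: Ar.
Qed.

Lemma closed_mdist_le x r : closed [set y | mdist x y <= r].
Proof. exact/closed_sublevel/continuous_mdist. Qed.

Lemma r_bounded_closure r A : r_bounded r A -> r_bounded r (closure A).
Proof.
move=> /r_boundedP Ar; apply/r_boundedP.
(* One variable at a time: first the second point moves to the closure, then
   the first. *)
have cl x : (forall y, A y -> mdist x y <= r) ->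
    forall y, closure A y -> mdist x y <= r.
  by move=> Axr y; exact: (closure_sub_closed _ _ _ (closed_mdist_le x r) Axr).
move=> x y clx; apply: (cl) => z Az; rewrite metric_sym.
by apply: cl clx => t At; exact: Ar.
Qed.

Lemma r_bounded1 x r : 0 <= r -> r_bounded r [set x].
Proof. by move=> r0; apply/r_boundedP => _ _ -> ->; rewrite mdistxx. Qed.

(** The empty set is r-bounded but never maximal, since singletons are
    r-bounded too. *)
Lemma r_maximal_nonempty r A :
  [set: X] !=set0 -> 0 <= r -> r_maximal r A -> A !=set0.
Proof.
move=> [x _] r0 [_ /(_ [set x] (r_bounded1 x r r0)) Amax].
have [//|/nonemptyPn A0] := pselect (A !=set0).
by rewrite -Amax; [exists x|rewrite A0; exact: sub0set].
Qed.

Lemma r_maximal_closed r A : r_maximal r A -> closed A.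
Proof.
move=> [Ar Amax].
rewrite -(Amax _ (r_bounded_closure _ _ Ar) (@subset_closure _ A)).
exact: closed_closure.
Qed.

Lemma proper_compact_closed_ball x r :
  proper_metric X -> compact [set y | mdist x y <= r].
Proof.
move=> pX.
have -> : [set y | mdist x y <= r] = mdist x @^-1` `[0, r].
  by apply/seteqP; split=> y /=; rewrite in_itv/= mdist_ge0.
apply: pX; last exact: segment_compact.
by move=> y /=; rewrite !in_itv/= => /andP[->].
Qed.

Lemma proper_compact_bounded r A :
  proper_metric X -> closed A -> r_bounded r A -> compact A.
Proof.
move=> pX clA /r_boundedP Ar.
have [[x Ax]|/nonemptyPn ->] := pselect (A !=set0); last exact: compact0.
apply: (subclosed_compact clA (proper_compact_closed_ball x r pX)).
by move=> y Ay; exact: Ar.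
Qed.

(** The image of U under the distance to x is relatively open in the half-line,
    and every relative neighbourhood of a value extends to its right, including
    at the end point 0. *)
Lemma open_metric_increase x y (U : set X) : open_metric X -> open U -> U y ->
  exists2 z, U z & mdist x y < mdist x z.
Proof.
move=> oX oU Uy; have [V oV imUV] := oX x U oU.
have Vy : V (mdist x y).
  by have : (mdist x @` U) (mdist x y) by [exists y]; rewrite imUV => -[].
have [e /= e0 eV] := (@nbhs_ballP _ _ _ _).1 (open_nbhs_nbhs (conj oV Vy)).
have : (`[0, +oo[ `&` V) (mdist x y + e / 2).
  split; first by rewrite /= in_itv/= andbT addr_ge0 ?mdist_ge0// ltW ?divr_gt0.
  apply: eV; rewrite /ball/= opprD addrA subrr sub0r normrN gtr0_norm.
    by rewrite ltr_pdivrMr// ltr_pMr// ltr1n.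
  by rewrite divr_gt0.
rewrite -imUV => -[z Uz xz]; exists z => //.
by rewrite xz ltrDl divr_gt0.
Qed.

(** If d(x, y) were r, then [open_metric_increase] would produce a point of A
    near y at distance more than r from x. *)
Lemma r_bounded_interior r A x y : open_metric X -> r_bounded r A ->
  A x -> interior A y -> mdist x y < r.
Proof.
move=> oX /r_boundedP Ar Ax Ay.
have [z Az] := open_metric_increase x y _ oX (@open_interior _ A) Ay.
by move=> /lt_le_trans; apply; apply: Ar => //; exact: interior_subset.
Qed.

End bounded_sets.

(** * The distance to the farthest point of a compact set *)

Section farthest_distance.
Context {R : realType} {X : metricType R} (C : set X).
Hypotheses (C0 : C !=set0) (cC : compact C).
Implicit Types (x y : X) (r s : R).

Lemma dist_max_leP x r :
  dist_max C x <= r <-> forall y, C y -> mdist x y <= r.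
Proof.
have [y [Cy -> ymax]] := dist_maxP x C0 cC.
by split=> [yr z /ymax /le_trans|]; apply.
Qed.

Lemma dist_max_ltP x r :
  dist_max C x < r <-> forall y, C y -> mdist x y < r.
Proof.
have [y [Cy -> ymax]] := dist_maxP x C0 cC.
by split=> [yr z /ymax /le_lt_trans|]; apply.
Qed.

Lemma continuous_dist_max : continuous (dist_max C).
Proof.
have lip x y : dist_max C x <= mdist x y + dist_max C y.
  apply/dist_max_leP => z Cz; apply: le_trans (metric_triangle x y z) _.
  by rewrite lerD2l; apply/dist_max_leP: z Cz.
move=> x; apply/cvgrPdist_lt => e e0; near=> y.
have xy : mdist x y < e.
  near: y; have := nbhsx_ballx x e e0; by rewrite ballEmdist.
apply: le_lt_trans xy; rewrite ler_norml lerNl opprB !lerBlDr lip andbT.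
by rewrite metric_sym lip.
Unshelve. all: by end_near. Qed.

Lemma proper_compact_dist_max_le r :
  proper_metric X -> compact [set x | dist_max C x <= r].
Proof.
move=> pX; have [c Cc] := C0.
apply: (subclosed_compact _ (proper_compact_closed_ball c r pX)).
  exact/closed_sublevel/continuous_dist_max.
by move=> x /= /dist_max_leP /(_ c Cc); rewrite metric_sym.
Qed.

Lemma connected_dist_max_le r : proper_metric X -> connected_metric X ->
  0 < r -> connected [set x | dist_max C x <= r].
Proof.
move=> pX conX r0.
apply: (@connected_closed_sublevel R X (dist_max C) r (r + 1)).
- exact: pseudometric_normal.
- exact: continuous_dist_max.
- by rewrite ltrDl.
- exact: proper_compact_dist_max_le.
- by move=> s rs _; apply: (conX C s C0 cC _).1; exact: lt_trans rs.
Qed.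

Lemma open_dist_max_lt r : open [set x | dist_max C x < r].
Proof.
apply: (@open_comp _ _ (dist_max C) [set z | z < r]); last exact: open_lt.
by move=> x _; exact: continuous_dist_max.
Qed.

Lemma r_bounded_superset r B :
  r_bounded r B -> C `<=` B -> B `<=` [set x | dist_max C x <= r].
Proof.
move=> /r_boundedP Br CB x Bx; apply/dist_max_leP => y /CB; exact: Br.
Qed.

(** A point within r of all of C can be added to C, so maximality forces it to
    belong to C already. *)
Lemma r_maximal_dist_maxE r :
  0 <= r -> r_maximal r C -> C = [set x | dist_max C x <= r].
Proof.
move=> r0 [Cr Cmax]; apply/seteqP; split; first exact: r_bounded_superset.
move=> x /dist_max_leP xr; rewrite -(Cmax (x |` C)); first by left.
  move/r_boundedP: Cr => Cr; apply/r_boundedP => y z [->|Cy] [->|Cz].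
  - by rewrite mdistxx.
  - exact: xr.
  - by rewrite metric_sym; exact: xr.
  - exact: Cr.
by move=> y; right.
Qed.

Lemma interior_sub_dist_max_lt r : open_metric X -> r_bounded r C ->
  interior C `<=` [set x | dist_max C x < r].
Proof.
move=> oX Cr x Cx; apply/dist_max_ltP => y Cy; rewrite metric_sym.
exact: (r_bounded_interior r C).
Qed.

(** No boundary point of C satisfies d_+ < r, so the interior and the complement
    of C are two disjoint open sets that cover the connected set where d_+ < r;
    it meets the interior, hence misses the complement. *)
Lemma dist_max_lt_sub_of_boundary r :
  open_metric X -> connected_metric X -> 0 < r -> r_bounded r C ->
  interior C !=set0 ->
  (forall x, boundary C x -> exists2 y, C y & mdist x y = r) ->
  [set x | dist_max C x < r] `<=` C.
Proof.
move=> oX conX r0 Cr [c Cc] bC.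
have clC : closed C by apply: compact_closed cC; exact: metric_hausdorff.
have sep : separated (interior C) (~` C).
  apply: (separated_subset_open _ (interior C) (~` C)) => //.
  - exact: open_interior.
  - exact: closed_openC.
  - by apply/disjoints_subset; rewrite setCK; exact: interior_subset.
have cover : [set x | dist_max C x < r] `<=` interior C `|` ~` C.
  move=> x /dist_max_ltP xr.
  have [Cx|] := pselect (C x); last by right.
  left; apply: contrapT => nCx.
  have [y Cy xy] := bC x (conj (subset_closure Cx) nCx).
  by have := xr y Cy; rewrite xy ltxx.
have [inC|outC] := connected_subset sep cover (conX C r C0 cC r0).1.
  by move=> x /inC /interior_subset.
have /outC : dist_max C c < r by exact: interior_sub_dist_max_lt.
by case; exact: interior_subset.
Qed.

End farthest_distance.

(** * Maximal bounded sets *)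

Theorem theorem0p1 (R : realType) (X : metricType R)
    (X_nonempty : [set: X] !=set0)
    (d_proper : proper_metric X) (d_open : open_metric X)
    (r : R) (r_gt0 : 0 < r) :
  (forall C : set X, r_maximal r C ->
     [/\ compact C,
         forall x1, boundary C x1 -> exists2 x2, boundary C x2 & mdist x1 x2 = r,
         C = [set x | dist_max C x <= r],
         interior C = [set x | dist_max C x < r] &
         connected_metric X -> connected C]) /\
  (connected_metric X ->
   forall C : set X, compact C -> r_bounded r C -> interior C !=set0 ->
     (forall x, boundary C x -> exists2 y, C y & mdist x y = r) ->
     r_maximal r C).
Proof.
split=> [C Cmax|conX C cC Cr intC bC].
  have Cr := Cmax.1; have clC := r_maximal_closed r C Cmax.
  have C0 := r_maximal_nonempty r C X_nonempty (ltW r_gt0) Cmax.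
  have cC := proper_compact_bounded r C d_proper clC Cr.
  have CE := r_maximal_dist_maxE C C0 cC r (ltW r_gt0) Cmax.
  have intE : interior C = [set x | dist_max C x < r].
    apply/seteqP; split; first exact: interior_sub_dist_max_lt.
    rewrite -open_subsetE; last exact: open_dist_max_lt.
    by move=> x /ltW xr; rewrite CE.
  split=> //; last by rewrite CE => conX; exact: connected_dist_max_le.
  move=> x [clx nix]; have {clx}Cx : C x by rewrite (closure_id C).1.
  have [y [Cy xy ymax]] := dist_maxP x C0 cC.
  have xyr : mdist x y = r.
    apply/eqP; rewrite eq_le -xy; apply/andP; split.
      by move: Cx; rewrite {1}CE.
    by rewrite leNgt; apply/negP => xr; apply: nix; rewrite intE.
  exists y => //; split; first exact: subset_closure.
  (* An interior y would be strictly closer than r to every point of C. *)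
  move=> inty; have := r_bounded_interior r C x y d_open Cr Cx inty.
  by rewrite xyr ltxx.
split=> // B Br CB; apply/seteqP; split=> //.
have C0 : C !=set0 by case: intC => c /interior_subset; exists c.
have clC : closed C by apply: compact_closed cC; exact: metric_hausdorff.
have ltC := dist_max_lt_sub_of_boundary C C0 cC r d_open conX r_gt0 Cr intC bC.
have lt0 : [set x | dist_max C x < r] !=set0.
  by case: intC => c Cc; exists c; exact: interior_sub_dist_max_lt.
apply: subset_trans (r_bounded_superset C C0 cC r B Br CB) _.
by rewrite -((conX C r C0 cC r_gt0).2 lt0); exact: closure_sub_closed.
Qed.
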